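(* Let $x_0\in[-1,1]$ be a fixed point and let $n\ge 1$ be an integer. Then every $P_n\in\triangle_n$ satisfies $$|P_n'(x_0)|\le 2\max\bigl(S_k(x_0),S_k(-x_0)\bigr)\,\|P_n\|\quad\text{if } n=2k+2,\ k\ge 0,$$ and $$|P_n'(x_0)|\le 2\max\bigl(F_k(x_0),H_k(x_0)\bigr)\,\|P_n\|\quad\text{if } n=2k+1,\ k\ge 0.$$ Moreover, these inequalities are sharp: for each $x_0\in[-1,1]$ and each $n\ge1$, the constant multiplying $\|P_n\|$ on the right-hand side cannot be replaced by a smaller one, i.e. it equals $\sup_{P_n\in\triangle_n}|P_n'(x_0)|/\|P_n\|$.
   Context: All polynomials are real algebraic polynomials in one variable. $\|f\|=\max_{x\in[-1,1]}|f(x)|$ is the uniform norm on $[-1,1]$. $\triangle_n$ denotes the set of all polynomials of degree $n$ that are monotone (nondecreasing or nonincreasing) on $[-1,1]$. For $\alpha,\beta\in\{0,1\}$, $J_l^{(\alpha,\beta)}$ ($l=0,1,2,\dots$) denotes the orthonormal Jacobi polynomial of degree $l$ with respect to the weight $(1-x)^\alpha(1+x)^\beta$ on $[-1,1]$, i.e. $\deg J_l^{(\alpha,\beta)}=l$ and $$\int_{-1}^1 J_l^{(\alpha,\beta)}(x)J_m^{(\alpha,\beta)}(x)(1-x)^\alpha(1+x)^\beta\,dx=\delta_{lm}$$ (the sign of the leading coefficient is irrelevant below, since only squares occur). For integers $k\ge 0$ define $$S_k(x)=(1+x)\sum_{l=0}^{k}\bigl(J_l^{(0,1)}(x)\bigr)^2,\qquad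 H_k(x)=(1-x^2)\sum_{l=0}^{k-1}\bigl(J_l^{(1,1)}(x)\bigr)^2,\qquad F_k(x)=\sum_{l=0}^{k}\bigl(J_l^{(0,0)}(x)\bigr)^2,$$ with the empty sum equal to zero, so $H_0=0$. *)

(* Defs.v *)
From HB Require Import structures.
From mathcomp Require Import all_boot all_order all_algebra.
From mathcomp Require Import all_classical all_reals all_analysis.

Set Implicit Arguments.
Unset Strict Implicit.
Unset Printing Implicit Defensive.

Import Order.TTheory GRing.Theory Num.Theory.

Local Open Scope classical_set_scope.
Local Open Scope ring_scope.

Section Defs.
Context {R : realType}.
Implicit Types (p P : {poly R}) (J : nat -> {poly R}) (x : R) (n k : nat).

(* The supremum is a maximum, since p is continuous and [-1, 1] is compact. *)
Definition unorm p : R := sup [set `|p.[x]| | x in `[-1, 1]].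

(* Degree exactly n: the size of a polynomial is its degree plus one. *)
Definition monotone_poly n : set {poly R} := [set P : {poly R} |
  size P = n.+1 /\
  ({in `[-1, 1] &, {homo horner P : x y / x <= y}} \/
   {in `[-1, 1] &, {homo horner P : x y /~ x <= y}})].

(* This determines J up to the sign of each J l. *)
Definition orthonormal_jacobi (a b : nat) J : Prop :=
  (forall l, size (J l) = l.+1) /\
  (forall l m,
    \int[lebesgue_measure]_(x in `[-1, 1])
      ((J l).[x] * (J m).[x] * (1 - x) ^+ a * (1 + x) ^+ b) = (l == m)%:R).

Definition S_ (J01 : nat -> {poly R}) k x : R :=
  (1 + x) * \sum_(l < k.+1) (J01 l).[x] ^+ 2.

Definition H_ (J11 : nat -> {poly R}) k x : R :=
  (1 - x ^+ 2) * \sum_(l < k) (J11 l).[x] ^+ 2.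

Definition F_ (J00 : nat -> {poly R}) k x : R :=
  \sum_(l < k.+1) (J00 l).[x] ^+ 2.

End Defs.

(* Main.v *)
Require Import Defs.
From mathcomp Require Import all_boot all_order all_algebra.
From mathcomp Require Import all_classical all_reals all_analysis.
From mathcomp Require Import ring lra zify.

(* The derivative of a monotone polynomial has constant sign, and a polynomial
   nonnegative on [-1, 1] is a sum of terms w A^2, where
   w = (1 - X)^a (1 + X)^b with a, b <= 1 and a + b has the parity of the
   degree. Expanding A in the orthonormal basis for w, Cauchy-Schwarz bounds
   w(x0) A(x0)^2 by the Christoffel function w(x0) \sum J_l(x0)^2 times the
   integral of w A^2, with equality for the kernel A = \sum J_l(x0) J_l. The
   integral of P' over [-1, 1] is at most 2 ||P||, with equality when
   P(-1) = - P(1). For weight 1 - X, the reflection x -> -x reduces to 1 + X. *)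

Set Implicit Arguments.
Unset Strict Implicit.
Unset Printing Implicit Defensive.

Import Order.TTheory GRing.Theory Num.Theory.
Import numFieldNormedType.Exports.

Local Open Scope classical_set_scope.
Local Open Scope ring_scope.

(** The sum of the squares [(D * c l - B * d l) ^+ 2] equals [D * (D * C - B ^+ 2)], so [D] can be
    divided out when positive; if [D = 0], every [d l] vanishes and so does [B]. *)
Lemma sum_CauchySchwarz {R : realFieldType} n (c d : nat -> R) :
  (\sum_(l < n) c l * d l) ^+ 2 <=
    (\sum_(l < n) d l ^+ 2) * (\sum_(l < n) c l ^+ 2).
Proof.
set B := \sum_(l < n) _ * _; set D := \sum_(l < n) d l ^+ 2.
set C := \sum_(l < n) c l ^+ 2.
have D_ge0 : 0 <= D by apply: sumr_ge0 => l _; exact: sqr_ge0.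
have sum_sqr u v : \sum_(l < n) (u * c l - v * d l) ^+ 2 =
    u ^+ 2 * C - (2 * u * v) * B + v ^+ 2 * D.
  rewrite /B /C /D !mulr_sumr -sumrB -big_split /=.
  by apply: eq_bigr => l _; ring.
have : 0 <= D * (D * C - B ^+ 2).
  rewrite (_ : _ * _ = \sum_(l < n) (D * c l - B * d l) ^+ 2).
    by apply: sumr_ge0 => l _; exact: sqr_ge0.
  by rewrite sum_sqr; ring.
move: D_ge0; rewrite le_eqVlt => /predU1P[D_eq0 _|D_gt0]; last first.
  by rewrite pmulr_rge0// subr_ge0.
rewrite -D_eq0 mul0r (_ : B = 0) ?expr0n//; apply: big1 => l _.
have /psumr_eq0P/(_ l isT)/eqP : \sum_(l < n) d l ^+ 2 = 0 by [].
by rewrite sqrf_eq0 => /(_ (fun _ _ => sqr_ge0 _))/eqP->; rewrite mulr0.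
Qed.

(** * Nonnegativity and integration of polynomials on [-1, 1] *)

Section PolynomialsOnInterval.
Context {R : realType}.
Implicit Types (p q A G P : {poly R}) (x c : R) (m n s : nat).

Lemma poly_ge0_closed_itv p a b : a < b ->
  (forall x, a < x < b -> 0 <= p.[x]) -> forall x, a <= x <= b -> 0 <= p.[x].
Proof.
move=> ab p_ge0 x xab; rewrite leNgt; apply/negP => px.
have /nbhs_ballP[e /= e0 He] : \forall y \near x, p.[y] < 0.
  exact: (cvgr_lt _ (@continuous_horner _ p x)).
(* The point [x] is moved a fraction [t] of the way to the midpoint: [0 < t <= 1/2] puts [y]
   strictly inside, and [t * (b - a) < e] keeps it in the ball where [p] is negative. *)
pose t := Num.min 1 (e / (b - a)) / 2.
have t0 : 0 < t by rewrite divr_gt0// lt_min ltr01 divr_gt0// subr_gt0.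
have t1 : t <= 1 / 2 by rewrite ler_pM2r ?invr_gt0// ge_min lexx.
have te : t * (b - a) < e.
  have : t * 2 <= e / (b - a) by rewrite divfK ?pnatr_eq0// ge_min lexx orbT.
  by rewrite ler_pdivlMr ?subr_gt0//; nra.
pose y := x + t * ((a + b) / 2 - x).
have yab : a < y < b by rewrite /y; apply/andP; split; nra.
suff /He : ball x e y by rewrite ltNge p_ge0.
rewrite /ball /= /y opprD addNKr normrN ltr_norml; apply/andP; split; nra.
Qed.

Definition nonneg_on_itv p := forall x, -1 <= x <= 1 -> 0 <= p.[x].

Lemma poly_primitive p :
  exists2 P, P^`() = p & p != 0 -> size P = (size p).+1.
Proof.
(* At [i = 0] the division by zero yields 0, so the constant term is 0. *)
exists (\poly_(i < (size p).+1) (p`_i.-1 / i%:R)) => [|p0].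
  apply/polyP => i; rewrite coef_deriv coef_poly ltnS /=.
  case: ltnP => [_|/leq_sizeP->//]; last by rewrite mul0rn.
  by rewrite -[LHS]mulr_natr divfK// pnatr_eq0.
rewrite size_poly_eq//= mulf_neq0// ?invr_eq0 ?pnatr_eq0 ?size_poly_eq0//.
by rewrite -lead_coefE lead_coef_eq0.
Qed.

Definition pint p : R := \int[lebesgue_measure]_(x in `[-1, 1]) p.[x].

Lemma pint_deriv p : pint p^`() = p.[1] - p.[-1].
Proof.
rewrite /pint /Rintegral (@continuous_FTC2 _ _ (horner p))//.
- by apply: continuous_subspaceT => x; exact: continuous_horner.
- split=> [x _| |]; first exact: derivable_horner.
    by apply: cvg_at_right_filter; exact: continuous_horner.
  by apply: cvg_at_left_filter; exact: continuous_horner.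
- by move=> x _; rewrite -derivE.
Qed.

(** Going through primitives makes the integral a difference of endpoint values, so no integrability
    condition arises. *)
Lemma pintD p q : pint (p + q) = pint p + pint q.
Proof.
have [P <- _] := poly_primitive p; have [Q <- _] := poly_primitive q.
by rewrite -derivD !pint_deriv !hornerD; ring.
Qed.

Lemma pintZ c p : pint (c *: p) = c * pint p.
Proof.
by have [P <- _] := poly_primitive p; rewrite -derivZ !pint_deriv !hornerZ; ring.
Qed.

Lemma pint_sum n (F : 'I_n -> {poly R}) :
  pint (\sum_(i < n) F i) = \sum_(i < n) pint (F i).
Proof.
have pint0 : pint 0 = 0 by rewrite -(scale0r 0) pintZ mul0r.
exact: (big_morph _ pintD pint0).
Qed.

Lemma pint_reflect p : pint (p \Po - 'X) = pint p.
Proof.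
have [P <- _] := poly_primitive p.
have -> : P^`() \Po - 'X = (- (P \Po - 'X))^`().
  by rewrite derivN deriv_comp derivN derivX mulrN1 opprK.
by rewrite !pint_deriv !hornerN !horner_comp !hornerN !hornerX !opprK; ring.
Qed.

Lemma pint_ge0 p : nonneg_on_itv p -> 0 <= pint p.
Proof. by move=> p0; apply: Rintegral_ge0 => x /=; rewrite in_itv/=; exact: p0. Qed.

End PolynomialsOnInterval.

(** * Nonnegative polynomials as sums of weighted squares *)

Section WeakLukacs.
Context {R : realType}.
Implicit Types (p q A G P : {poly R}) (x c : R) (m n s a b : nat).

Definition jweight a b : {poly R} := (1 - 'X) ^+ a * (1 + 'X) ^+ b.

Lemma horner_jweight a b x : (jweight a b).[x] = (1 - x) ^+ a * (1 + x) ^+ b.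
Proof. by rewrite /jweight hornerM !horner_exp !hornerE. Qed.

Lemma nonneg_jweight_sqr a b A : nonneg_on_itv (jweight a b * A ^+ 2).
Proof.
move=> x x1; rewrite hornerM horner_jweight horner_exp.
by rewrite mulr_ge0 ?sqr_ge0// mulr_ge0// exprn_ge0//; lra.
Qed.

(** The index [m] bounds the degree: a term has degree at most [a + b + 2 * (s - 1) = m]. As this is
    an equality, [a + b] has the parity of [m], which leaves two weights for each parity. *)
Inductive wsos : nat -> {poly R} -> Prop :=
| wsos_sqr m a b s A : (a <= 1)%N -> (b <= 1)%N -> (a + b + s.*2 = m.+2)%N ->
    (size A <= s)%N -> wsos m (jweight a b * A ^+ 2)
| wsosD m p q : wsos m p -> wsos m q -> wsos m (p + q).

Lemma size_mul_le2 p q s : (size p <= 2)%N -> (size q <= s)%N ->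
  (size (p * q)%R <= s.+1)%N.
Proof. by move=> p2 qs; apply: leq_trans (size_polyMleq _ _) _; lia. Qed.

Lemma size_onemX : (size (1 - 'X : {poly R})%R <= 2)%N.
Proof.
by rewrite (leq_trans (size_polyD _ _))// size_polyN size_polyX size_poly1.
Qed.

Lemma size_onepX : (size (1 + 'X : {poly R})%R <= 2)%N.
Proof.
by rewrite (leq_trans (size_polyD _ _))// size_polyX size_poly1.
Qed.

(** The factor goes into the weight if [a = 0]; if [a = 1], the weight already holds one copy and
    the resulting square goes into [A]. *)
Lemma wsos_mulonem m p : wsos m p -> wsos m.+1 ((1 - 'X) * p).
Proof.
elim=> {m p} [m [|[|//]] b s A _ b1 absm As|m p q _ IHp _ IHq]; last 1 first.
- by rewrite mulrDr; exact: wsosD.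
- rewrite [X in wsos _ X](_ : _ = jweight 1 b * A ^+ 2); last first.
    by rewrite /jweight ?expr0 ?expr1; ring.
  by apply: (wsos_sqr (s := s)) => //; lia.
- rewrite [X in wsos _ X](_ : _ = jweight 0 b * ((1 - 'X) * A) ^+ 2); last first.
    by rewrite /jweight ?expr0 ?expr1; ring.
  by apply: (wsos_sqr (s := s.+1)) => //; [lia|exact: size_mul_le2 size_onemX _].
Qed.

Lemma wsos_mulonep m p : wsos m p -> wsos m.+1 ((1 + 'X) * p).
Proof.
elim=> {m p} [m a [|[|//]] s A a1 _ absm As|m p q _ IHp _ IHq]; last 1 first.
- by rewrite mulrDr; exact: wsosD.
- rewrite [X in wsos _ X](_ : _ = jweight a 1 * A ^+ 2); last first.
    by rewrite /jweight ?expr0 ?expr1; ring.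
  by apply: (wsos_sqr (s := s)) => //; lia.
- rewrite [X in wsos _ X](_ : _ = jweight a 0 * ((1 + 'X) * A) ^+ 2); last first.
    by rewrite /jweight ?expr0 ?expr1; ring.
  by apply: (wsos_sqr (s := s.+1)) => //; [lia|exact: size_mul_le2 size_onepX _].
Qed.

Lemma wsosZ m p c : 0 <= c -> wsos m p -> wsos m (c *: p).
Proof.
move=> c0; elim=> {m p} [m a b s A a1 b1 absm As|m p q _ IHp _ IHq].
  rewrite (_ : _ *: _ = jweight a b * (Num.sqrt c *: A) ^+ 2).
    by apply: (wsos_sqr (s := s)) => //; rewrite (leq_trans (size_scale_leq _ _)).
  by rewrite exprZn sqr_sqrtr// scalerAr.
by rewrite scalerDr; exact: wsosD.
Qed.

(** Not a mere weakening, since the parity of [a + b] changes; it follows from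
    [1 = ((1 - X) + (1 + X)) / 2]. *)
Lemma wsosS m p : wsos m p -> wsos m.+1 p.
Proof.
move=> mp; have -> : p = 2^-1 *: ((1 - 'X) * p + (1 + 'X) * p).
  rewrite -mulrDl (_ : _ + _ = 2%:R%:P); last by rewrite polyC_natr; ring.
  by rewrite mul_polyC scalerA mulVf ?scale1r ?pnatr_eq0.
apply: wsosZ; first by rewrite invr_ge0.
by apply: wsosD; [exact: wsos_mulonem|exact: wsos_mulonep].
Qed.

Lemma wsos_mul_sqr m p q : (size q <= 2)%N -> wsos m p -> wsos m.+2 (q ^+ 2 * p).
Proof.
move=> q2; elim=> {m p} [m a b s A a1 b1 absm As|m p r _ IHp _ IHr].
  rewrite mulrCA -exprMn; apply: (wsos_sqr (s := s.+1)) => //; first by lia.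
  exact: size_mul_le2.
by rewrite mulrDr; exact: wsosD.
Qed.

Lemma wsosC m c : 0 <= c -> wsos m c%:P.
Proof.
move=> c0; elim: m => [|m]; last exact: wsosS.
rewrite (_ : c%:P = jweight 0 0 * (Num.sqrt c)%:P ^+ 2).
  by apply: (wsos_sqr (s := 1)) => //; rewrite size_polyC; case: eqP.
by rewrite -polyC_exp sqr_sqrtr// /jweight !expr0 !mul1r.
Qed.

Lemma size_divXsubC q q1 x m : q = q1 * ('X - x%:P) ->
  (size q <= m.+1)%N -> (size q1 <= m)%N.
Proof.
move=> ->; have [->|q1_neq0] := eqVneq q1 0; first by rewrite size_poly0.
by rewrite size_Mmonic ?monicXsubC// size_XsubC addn2.
Qed.

(** The cofactor is nonpositive to the left of [x] and nonnegative to the right, hence zero at [x]: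
    an interior root has even multiplicity, so [X - x] divides out twice. *)
Lemma root_nonneg_interior q q1 x : -1 < x < 1 -> q = q1 * ('X - x%:P) ->
  nonneg_on_itv q -> root q1 x.
Proof.
move=> x1 qE q0; apply/rootP/eqP; rewrite eq_le; apply/andP; split.
  rewrite -oppr_ge0 -hornerN.
  apply: (@poly_ge0_closed_itv _ _ (-1) x); try lra.
  move=> y y1; have := q0 y; rewrite qE hornerM hornerXsubC hornerN => h.
  rewrite oppr_ge0 leNgt; apply/negP => q1y.
  by have := h ltac:(lra); rewrite pmulr_rge0//; lra.
apply: (@poly_ge0_closed_itv _ _ x 1); try lra.
move=> y y1; have := q0 y; rewrite qE hornerM hornerXsubC => h.
by have := h ltac:(lra); rewrite pmulr_lge0//; lra.
Qed.

(* A weak form of Lukacs' theorem, with sums of squares: subtracting the minimum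
   creates a root, and dividing it out lowers the degree. *)
Lemma nonneg_wsos m p : (size p <= m.+1)%N -> nonneg_on_itv p -> wsos m p.
Proof.
elim/ltn_ind: m p => m IH p pm p0.
have [r] : exists2 c, c \in `[-1, 1] & forall t, t \in `[-1, 1] -> p.[c] <= p.[t].
  apply: EVT_min; first by lra.
  by apply: continuous_subspaceT => x; exact: continuous_horner.
rewrite in_itv/= => r1 rmin.
pose q := p - p.[r]%:P.
have q0 : nonneg_on_itv q.
  by move=> x x1; rewrite !hornerE subr_ge0 rmin// in_itv.
suff : wsos m q.
  move=> mq; rewrite -(subrK p.[r]%:P p); apply: wsosD => //.
  by apply: wsosC; exact: p0.
have qm : (size q <= m.+1)%N.
  rewrite (leq_trans (size_polyD _ _))// geq_max pm size_polyN size_polyC.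
  by case: eqP.
have : root q r by rewrite rootE !hornerE subrr.
move=> /factor_theorem[q1 qE].
have := size_divXsubC qE qm.
case: m IH {pm} qm => [_ _|m IH qm q1m].
  by rewrite leqn0 size_poly_eq0 => /eqP q10; rewrite qE q10 mul0r; exact: wsosC.
(* A root at an endpoint splits off [1 + X] or [1 - X] with a nonnegative cofactor; an interior root
   splits off a square. *)
have [r_eq|rN1] := eqVneq r (-1).
  rewrite qE mulrC (_ : 'X - _ = 1 + 'X); last by rewrite r_eq polyCN opprK addrC.
  apply/wsos_mulonep/IH => //.
  apply: poly_ge0_closed_itv => [|x x1]; first by lra.
  have : 0 <= q.[x] by apply: q0; lra.
  by rewrite qE hornerM hornerXsubC pmulr_lge0//; lra.
have [r_eq|rD1] := eqVneq r 1.
  rewrite qE (_ : _ * _ = (1 - 'X) * - q1); last by rewrite r_eq; ring.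
  apply/wsos_mulonem/IH => //; first by rewrite size_polyN.
  apply: poly_ge0_closed_itv => [|x x1]; first by lra.
  have : 0 <= q.[x] by apply: q0; lra.
  rewrite qE hornerM hornerXsubC hornerN -mulrNN pmulr_lge0//; lra.
have {}r1 : -1 < r < 1.
  by case/andP: r1 => ? ?; rewrite !lt_neqAle eq_sym rN1 rD1; apply/andP.
have /factor_theorem[q2 q1E] := root_nonneg_interior r1 qE q0.
have := size_divXsubC q1E q1m.
case: m IH {qm q1m} => [_|m IH q2m].
  rewrite leqn0 size_poly_eq0 => /eqP q20.
  by rewrite qE q1E q20 !mul0r; exact: wsosC.
have {}qE : q = ('X - r%:P) ^+ 2 * q2 by rewrite qE q1E; ring.
rewrite qE; apply: wsos_mul_sqr; first by rewrite size_XsubC.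
apply: IH => // x x1.
(* Division by a positive square gives the sign off [r]; the value at [r] itself comes from closing
   up a nondegenerate interval on one side. *)
have q2_ge0 y : -1 <= y <= 1 -> y != r -> 0 <= q2.[y].
  move=> y1 yr; have := q0 y y1.
  rewrite qE hornerM horner_exp hornerXsubC pmulr_rge0//.
  by rewrite exprn_even_gt0//= subr_eq0.
have [xr|xr] := leP x r.
  apply: (@poly_ge0_closed_itv _ _ (-1) r); try lra.
  by move=> y y1; apply: q2_ge0; [lra|rewrite lt_eqF//; lra].
apply: (@poly_ge0_closed_itv _ _ r 1); try lra.
by move=> y y1; apply: q2_ge0; [lra|rewrite gt_eqF//; lra].
Qed.

End WeakLukacs.

(** * Christoffel functions of the orthonormal Jacobi polynomials *)

Section JacobiKernel.
Context {R : realType}.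
Variables (a b : nat) (J : nat -> {poly R}).
Hypothesis J_orthonormal : orthonormal_jacobi a b J.
Implicit Types (A G : {poly R}) (x c : R) (s : nat).

Let pint_orthonormal l m : pint (jweight a b * (J l * J m)) = (l == m)%:R.
Proof.
rewrite -(J_orthonormal.2 l m); congr Rintegral; apply/funext => x.
by rewrite hornerM horner_jweight hornerM; ring.
Qed.

(** Each [J s] has exact degree [s], so subtracting a multiple of it cancels the top coefficient of
    [A]. *)
Lemma jacobi_basis s A : (size A <= s)%N ->
  exists c : nat -> R, A = \sum_(l < s) c l *: J l.
Proof.
elim: s A => [|s IH] A As.
  by exists (fun=> 0); rewrite big_ord0; apply/eqP; rewrite -size_poly_eq0 -leqn0.
have sizeJ := J_orthonormal.1 s.
have lcJ : (J s)`_s != 0.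
  rewrite -[X in _`_X]/(s.+1.-1) -sizeJ -lead_coefE lead_coef_eq0.
  by rewrite -size_poly_eq0 sizeJ.
pose t := A`_s / (J s)`_s.
have [|c cE] := IH (A - t *: J s).
  apply/leq_sizeP => j; rewrite leq_eqVlt => /predU1P[<-|sj].
    by rewrite coefB coefZ divfK// subrr.
  by rewrite coefB coefZ !nth_default ?sizeJ ?(leq_trans As)// mulr0 subrr.
exists (fun l => if l == s then t else c l).
rewrite big_ord_recr /= eqxx -[A in LHS](subrK (t *: J s)) cE; congr (_ + _).
by apply: eq_bigr => l _; rewrite ltn_eqF.
Qed.

(** Parseval's identity for the weighted inner product. *)
Lemma pint_jacobi_sqr s (c : nat -> R) :
  pint (jweight a b * (\sum_(l < s) c l *: J l) ^+ 2) = \sum_(l < s) c l ^+ 2.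
Proof.
rewrite expr2 mulr_suml mulr_sumr pint_sum; apply: eq_bigr => i _.
rewrite !mulr_sumr pint_sum (bigD1 i)//= big1 ?addr0 => [|j ji].
  by rewrite -scalerAl -!scalerAr !pintZ pint_orthonormal eqxx mulr1.
rewrite -scalerAl -!scalerAr !pintZ pint_orthonormal.
by rewrite (_ : _ == _ = false) ?mulr0// eq_sym; apply/negbTE.
Qed.

Lemma jacobi_kernel_bound s A x : (size A <= s)%N -> -1 <= x <= 1 ->
  (jweight a b * A ^+ 2).[x] <=
    (jweight a b).[x] * (\sum_(l < s) (J l).[x] ^+ 2) * pint (jweight a b * A ^+ 2).
Proof.
move=> /jacobi_basis[c ->] x1; rewrite pint_jacobi_sqr hornerM -mulrA.
have w0 : 0 <= (jweight a b).[x].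
  by have := nonneg_jweight_sqr a b 1 x1; rewrite expr1n mulr1.
rewrite ler_wpM2l// horner_exp horner_sum.
under eq_bigr do rewrite hornerZ.
exact: (sum_CauchySchwarz _ c (fun l => (J l).[x])).
Qed.

(** For the kernel at [x], both the value at [x] and the weighted integral of the square equal [K];
    the hypothesis reads [w * K ^+ 2 <= c * K], and [K] cancels unless it is 0. *)
Lemma jacobi_kernel_sharp s x c : 0 <= c -> -1 <= x <= 1 ->
  (forall A, (size A <= s)%N ->
    (jweight a b * A ^+ 2).[x] <= c * pint (jweight a b * A ^+ 2)) ->
  (jweight a b).[x] * (\sum_(l < s) (J l).[x] ^+ 2) <= c.
Proof.
move=> c0 x1 /(_ (\sum_(l < s) (J l).[x] *: J l)).
rewrite (pint_jacobi_sqr _ (fun l => (J l).[x])) hornerM horner_exp.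
rewrite (_ : (\sum_(l < s) _).[x] = \sum_(l < s) (J l).[x] ^+ 2); last first.
  by rewrite horner_sum; apply: eq_bigr => l _; rewrite hornerZ -expr2.
have : 0 <= \sum_(l < s) (J l).[x] ^+ 2 by apply: sumr_ge0 => l _; exact: sqr_ge0.
set K := \sum_(l < s) _; rewrite le_eqVlt => /predU1P[<- _|K0]; first by rewrite mulr0.
rewrite expr2 mulrA ler_pM2r//; apply.
apply: (leq_trans (size_sum _ _ _)); apply/bigmax_leqP => l _.
by rewrite (leq_trans (size_scale_leq _ _))// J_orthonormal.1.
Qed.

End JacobiKernel.

(** * From monotone polynomials to their nonnegative derivatives *)

Section MonotonePolynomials.
Context {R : realType}.
Implicit Types (p q A G P : {poly R}) (x c D : R) (m n s : nat).

Lemma unorm_ub p x : -1 <= x <= 1 -> `|p.[x]| <= unorm p.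
Proof.
move=> x1; apply: sup_upper_bound; last by exists x => //=; rewrite in_itv.
split; first by exists `|p.[x]|, x => //=; rewrite in_itv.
have [c _ cmax] : exists2 c, c \in `[-1, 1] &
    forall t, t \in `[-1, 1] -> `|p.[t]| <= `|p.[c]|.
  apply: (@EVT_max _ (fun t => `|p.[t]|)); first by lra.
  apply: continuous_subspaceT => y; apply: cvg_norm; exact: continuous_horner.
by exists `|p.[c]| => _ [t t1 <-]; exact: cmax.
Qed.

Lemma unorm_le p M : (forall x, -1 <= x <= 1 -> `|p.[x]| <= M) -> unorm p <= M.
Proof.
move=> pM; apply: ge_sup.
  by exists `|p.[0]|, 0 => //=; rewrite in_itv/= lerN10 ler01.
by move=> _ [x /= x1 <-]; apply: pM; rewrite in_itv in x1.
Qed.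

Lemma unormN p : unorm (- p) = unorm p.
Proof. by congr sup; apply: eq_imagel => x _; rewrite hornerN normrN. Qed.

Lemma deriv_nonneg_homo p : nonneg_on_itv p^`() ->
  {in `[-1, 1] &, {homo horner p : x y / x <= y}}.
Proof.
move=> p0; apply: ger0_derive1_le_cc => [x _|x|]; first exact: derivable_horner.
  by rewrite -derivE in_itv/= => x1; apply: p0; lra.
by apply: continuous_subspaceT => x; exact: continuous_horner.
Qed.

(** The derivative at [x] is the value at [x] of the difference quotient [q], a polynomial that
    monotonicity makes nonnegative off [x], hence also at [x]. *)
Lemma homo_deriv_nonneg p : {in `[-1, 1] &, {homo horner p : x y / x <= y}} ->
  nonneg_on_itv p^`().
Proof.
move=> p_homo x x1.
have : root (p - p.[x]%:P) x by rewrite rootE !hornerE subrr.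
move=> /factor_theorem[q qE].
have -> : p^`().[x] = q.[x].
  rewrite (_ : p^`() = (p - p.[x]%:P)^`()); last by rewrite derivB derivC subr0.
  by rewrite qE derivM derivXsubC !hornerE subrr mulr0 add0r.
have q_ge0 y : -1 <= y <= 1 -> y != x -> 0 <= q.[y].
  move=> y1 yx; have := congr1 (horner^~ y) qE; rewrite !hornerE => pyx.
  have xI : x \in `[-1, 1] by rewrite in_itv.
  have yI : y \in `[-1, 1] by rewrite in_itv.
  move: yx; rewrite neq_lt => /orP[yx|xy].
    by have := p_homo _ _ yI xI (ltW yx) => ?;
      rewrite leNgt; apply/negP => ?; nra.
  by have := p_homo _ _ xI yI (ltW xy) => ?;
    rewrite leNgt; apply/negP => ?; nra.
have [x_gt|x_le] := ltP (-1) x.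
  apply: (@poly_ge0_closed_itv _ _ (-1) x); try lra.
  by move=> y y1; apply: q_ge0; [lra|rewrite lt_eqF//; lra].
apply: (@poly_ge0_closed_itv _ _ x 1); try lra.
by move=> y y1; apply: q_ge0; [lra|rewrite gt_eqF//; lra].
Qed.

Lemma monotone_poly_ndecr n P : monotone_poly n P ->
  exists Q : {poly R}, [/\ size Q = n.+1, nonneg_on_itv Q^`(), unorm P = unorm Q &
    forall x, `|P^`().[x]| = `|Q^`().[x]|].
Proof.
move=> [sP [P_incr|P_decr]].
  by exists P; split=> //; exact: homo_deriv_nonneg.
exists (- P); split; rewrite ?size_polyN ?unormN//; last first.
  by move=> x; rewrite derivN hornerN normrN.
apply: homo_deriv_nonneg => x y xI yI xy.
by rewrite !hornerN lerN2; exact: P_decr.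
Qed.

Lemma monotone_primitive n G : (0 < n)%N -> size G = n -> nonneg_on_itv G ->
  exists P, [/\ monotone_poly n P, P^`() = G & unorm P * 2 <= pint G].
Proof.
move=> n0 sG G0; have [Q QG sQ] := poly_primitive G.
have {}sQ : size Q = n.+1 by rewrite sQ ?sG// -size_poly_gt0 sG.
(* Centring makes the end values opposite, so the norm is half the total increase. *)
pose c := (Q.[1] + Q.[-1]) / 2.
have dP : (Q - c%:P)^`() = G by rewrite derivB derivC subr0.
have Qhomo := deriv_nonneg_homo (_ : nonneg_on_itv Q^`()).
exists (Q - c%:P); split=> //.
  split; first by rewrite size_polyDl// size_polyN size_polyC sQ; case: eqP.
  by left; apply: deriv_nonneg_homo; rewrite dP.
rewrite -QG pint_deriv -ler_pdivlMr//; apply: unorm_le => x x1.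
rewrite QG in Qhomo.
have xI : x \in `[-1, 1] by rewrite in_itv.
have hl : Q.[-1] <= Q.[x] by apply: Qhomo => //; rewrite ?in_itv/=; lra.
have hr : Q.[x] <= Q.[1] by apply: Qhomo => //; rewrite ?in_itv/=; lra.
by rewrite hornerD hornerN hornerC ler_norml /c; apply/andP; split; lra.
Qed.

(* A small multiple of [(1 + X)^(n-1)] is added to raise the degree. *)
Lemma nonneg_exact_degree n x c : (0 < n)%N -> -1 <= x <= 1 ->
  (forall G, size G = n -> nonneg_on_itv G -> G.[x] <= c * pint G) ->
  forall G, (size G <= n)%N -> nonneg_on_itv G -> G.[x] <= c * pint G.
Proof.
move=> n0 x1 cP G Gn G0; rewrite leNgt; apply/negP => Gx.
pose Q : {poly R} := ('X - (-1)%:P) ^+ n.-1.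
have Q0 : nonneg_on_itv Q.
  by move=> y y1; rewrite horner_exp hornerXsubC exprn_ge0//; lra.
have sQ : size Q = n by rewrite size_exp_XsubC prednK.
have lQ : Q`_n.-1 = 1.
  by rewrite -sQ -lead_coefE; apply/eqP; exact: monic_exp (monicXsubC _).
(* The condition on [t] says that the coefficient of degree [n - 1] survives, so that the perturbed
   polynomial has size exactly [n]. *)
have bound t : 0 < t -> G`_n.-1 + t != 0 ->
    G.[x] + t * Q.[x] <= c * (pint G + t * pint Q).
  move=> t0 Gt; rewrite -hornerZ -hornerD -pintZ -pintD; apply: cP.
    apply/eqP; rewrite eqn_leq; apply/andP; split.
      by rewrite (leq_trans (size_polyD _ _))// geq_max Gn size_scale ?gt_eqF// sQ /=.
    rewrite leqNgt; apply/negP => h; move/eqP: Gt; apply.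
    have := nth_default 0 (_ : (size (G + t *: Q)%R <= n.-1)%N).
    by rewrite coefD coefZ lQ mulr1; apply; rewrite -ltnS prednK.
  by move=> y y1; rewrite hornerD hornerZ addr_ge0 ?G0// mulr_ge0 ?Q0// ltW.
pose d := G.[x] - c * pint G.
have d0 : 0 < d by rewrite subr_gt0.
pose M := `|c * pint Q - Q.[x]|.
have M0 : 0 <= M by exact: normr_ge0.
have small t : 0 < t -> G`_n.-1 + t != 0 -> d <= t * M.
  move=> t0 Gt; have := bound t t0 Gt.
  have := ler_wpM2l (ltW t0) (ler_norm (c * pint Q - Q.[x])).
  by rewrite -/M /d; lra.
pose t := d / (2 * (M + 1)).
have t0 : 0 < t by rewrite divr_gt0// mulr_gt0//; lra.
have tM : t * M < d.
  have : t * (2 * (M + 1)) = d by rewrite divfK// mulf_neq0// gt_eqF//; lra.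
  by nra.
(* Only one value of [t] can cancel the top coefficient; if it is this one, [t / 2] does not cancel
   it and is still small enough. *)
have [Gt|Gt] := eqVneq (G`_n.-1 + t) 0; last by have := small t t0 Gt; lra.
have := small (t / 2) ltac:(lra).
have -> : G`_n.-1 + t / 2 != 0 by rewrite lt_eqF//; lra.
by move=> /(_ isT); nra.
Qed.

Lemma monotone_deriv_sharp x n D : -1 <= x <= 1 -> (0 < n)%N -> 0 <= D ->
  (forall G, (size G <= n)%N -> nonneg_on_itv G -> G.[x] <= D * pint G) ->
  (forall c, 0 <= c ->
    (forall G, (size G <= n)%N -> nonneg_on_itv G -> G.[x] <= c * pint G) ->
    D <= c) ->
  let C := 2 * D in
  (forall P, monotone_poly n P -> `|P^`().[x]| <= C * unorm P) /\
  (forall c, (forall P, monotone_poly n P -> `|P^`().[x]| <= c * unorm P) ->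
    C <= c) /\
  C = sup [set `|P^`().[x]| / unorm P | P in monotone_poly n].
Proof.
move=> x1 n0 D0 ubD lbD C.
have ubC P : monotone_poly n P -> `|P^`().[x]| <= C * unorm P.
  move=> /monotone_poly_ndecr[Q [sQ Q0 -> ->]].
  rewrite ger0_norm ?Q0//; apply: (le_trans (ubD _ _ Q0)).
    by rewrite -ltnS -sQ lt_size_deriv// -size_poly_gt0 sQ.
  rewrite pint_deriv /C -mulrA [leRHS]mulrCA ler_wpM2l//.
  have := ler_norml Q.[1] (unorm Q); rewrite unorm_ub; last by lra.
  have := ler_norml Q.[-1] (unorm Q); rewrite unorm_ub; last by lra.
  by move=> /esym/andP[? ?] /esym/andP[? ?]; lra.
have unorm_gt0 P : monotone_poly n P -> 0 < unorm P.
  move=> [sP _]; rewrite lt_neqAle.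
  have := unorm_ub P (x := 0); rewrite lerN10 ler01 => /(_ isT) h.
  rewrite (le_trans _ h)// andbT; apply/eqP => P0.
  have Proot t : -1 <= t <= 1 -> root P t.
    by move=> t1; rewrite rootE -normr_le0 P0 unorm_ub.
  have Pn0 : P != 0 by rewrite -size_poly_gt0 sP.
  (* These are [n + 1] distinct points of (0, 1], too many zeros for degree [n]. *)
  pose rs := [seq (i.+1%:R : R)^-1 | i <- iota 0 n.+1].
  apply: notF; have := max_poly_roots Pn0 (_ : all (root P) rs) (_ : uniq rs).
  rewrite size_map size_iota sP ltnn; apply.
    apply/allP => _ /mapP[i _ ->]; apply: Proot.
    rewrite invf_le1 ?ltr0n// ler1n andbT.
    by rewrite (le_trans (lerN10 _))// invr_ge0.
  rewrite map_inj_uniq ?iota_uniq// => i j /invr_inj/eqP.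
  by rewrite eqr_nat => /eqP[].
have exP : exists P, monotone_poly n P.
  have [||P [nP _ _]] := @monotone_primitive n (('X - (-1)%:P) ^+ n.-1) n0.
  - by rewrite size_exp_XsubC prednK.
  - by move=> y y1; rewrite horner_exp hornerXsubC exprn_ge0//; lra.
  - by exists P.
have lbC c :
    (forall P, monotone_poly n P -> `|P^`().[x]| <= c * unorm P) -> C <= c.
  move=> cP; rewrite /C mulrC -ler_pdivlMr//.
  (* Some monotone polynomial of degree [n] exists and has positive norm, which forces the sign of
     [c]. *)
  have c0 : 0 <= c.
    have [P nP] := exP.
    by rewrite -(pmulr_lge0 _ (unorm_gt0 _ nP)) (le_trans _ (cP _ nP)).
  apply: lbD; first by rewrite divr_ge0.
  apply: nonneg_exact_degree => // G sG G0.
  have [P [nP PG Pint]] := monotone_primitive n0 sG G0.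
  have := cP _ nP; rewrite PG => /ler_normlW h; apply: (le_trans h).
  by rewrite -mulrA ler_wpM2l// ler_pdivlMl// mulrC.
split=> //; split=> //; apply/eqP; rewrite eq_le; apply/andP; split.
  (* The supremum is itself an admissible constant, so minimality of [C] applies to it. *)
  apply: lbC => P nP; rewrite -ler_pdivrMr ?unorm_gt0//.
  apply: sup_upper_bound; last by exists P.
  split; first by exists (`|P^`().[x]| / unorm P), P.
  by exists C => _ [Q nQ <-]; rewrite ler_pdivrMr ?unorm_gt0// ubC.
apply: ge_sup => [|_ [Q nQ <-]]; last by rewrite ler_pdivrMr ?unorm_gt0// ubC.
by have [P nP] := exP; exists (`|P^`().[x]| / unorm P), P.
Qed.

End MonotonePolynomials.

(** * Reflection, and bounds on the generators of [wsos] *)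

Section Reflection.
Context {R : realType}.
Implicit Types (p A G : {poly R}) (x D : R) (m s a b : nat).

Lemma horner_reflect p x : (p \Po - 'X).[x] = p.[- x].
Proof. by rewrite horner_comp hornerN hornerX. Qed.

Lemma size_reflect p : size (p \Po - 'X) = size p.
Proof. by rewrite size_comp_poly2// size_polyN size_polyX. Qed.

Lemma jweight_reflect a b A :
  (jweight a b * A ^+ 2) \Po - 'X = jweight b a * (A \Po - 'X) ^+ 2.
Proof.
rewrite !rmorphM !rmorphXn /= comp_polyB comp_polyD comp_polyC comp_polyX opprK.
by rewrite /jweight; congr (_ * _); exact: mulrC.
Qed.

(** Both sides are additive in [G], so a single weighted square suffices. *)
Lemma wsos_le_pint m x D G :
  (forall a b s A, (a <= 1)%N -> (b <= 1)%N -> (a + b + s.*2 = m.+2)%N ->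
    (size A <= s)%N ->
    (jweight a b * A ^+ 2).[x] <= D * pint (jweight a b * A ^+ 2)) ->
  wsos m G -> G.[x] <= D * pint G.
Proof.
move=> + mG.
elim: mG => {m G} [m a b s A a1 b1 abm As|m p q _ IHp _ IHq] genD.
  exact: (genD _ _ s).
by rewrite hornerD pintD mulrDr lerD ?IHp ?IHq.
Qed.

Lemma jacobi_kernel_bound_le a b J s A x D : orthonormal_jacobi a b J ->
  (size A <= s)%N -> -1 <= x <= 1 ->
  (jweight a b).[x] * (\sum_(l < s) (J l).[x] ^+ 2) <= D ->
  (jweight a b * A ^+ 2).[x] <= D * pint (jweight a b * A ^+ 2).
Proof.
move=> hJ As x1 KD; apply: (le_trans (jacobi_kernel_bound hJ As x1)).
by rewrite ler_wpM2r// pint_ge0//; exact: nonneg_jweight_sqr.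
Qed.

End Reflection.

(** * The sharp constants in even and odd degree *)

Theorem theorem2p1 (R : realType) (J : nat -> nat -> nat -> {poly R})
    (hJ : forall a b : nat, (a <= 1)%N -> (b <= 1)%N ->
      orthonormal_jacobi a b (J a b))
    (x0 : R) (hx0 : x0 \in `[-1, 1]%R) (n : nat) (hn : (1 <= n)%N) :
  (forall k : nat, n = (2 * k + 2)%N ->
    let C := 2 * Num.max (S_ (J 0%N 1%N) k x0) (S_ (J 0%N 1%N) k (- x0)) in
    (forall P : {poly R}, monotone_poly n P -> `|P^`().[x0]| <= C * unorm P) /\
    (forall c : R,
      (forall P : {poly R}, monotone_poly n P -> `|P^`().[x0]| <= c * unorm P) ->
      C <= c) /\
    C = sup [set `|P^`().[x0]| / unorm P | P in monotone_poly n]) /\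
  (forall k : nat, n = (2 * k + 1)%N ->
    let C := 2 * Num.max (F_ (J 0%N 0%N) k x0) (H_ (J 1%N 1%N) k x0) in
    (forall P : {poly R}, monotone_poly n P -> `|P^`().[x0]| <= C * unorm P) /\
    (forall c : R,
      (forall P : {poly R}, monotone_poly n P -> `|P^`().[x0]| <= c * unorm P) ->
      C <= c) /\
    C = sup [set `|P^`().[x0]| / unorm P | P in monotone_poly n]).
Proof.
have x01 : -1 <= x0 <= 1 by rewrite in_itv in hx0.
have x01N : -1 <= - x0 <= 1 by lra.
have kernel_ge0 a b (Ja : nat -> {poly R}) s x : -1 <= x <= 1 ->
    0 <= (jweight a b).[x] * (\sum_(l < s) (Ja l).[x] ^+ 2).
  move=> x1; rewrite mulr_ge0 ?sumr_ge0// => [|l _]; last exact: sqr_ge0.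
  by have := nonneg_jweight_sqr a b 1 x1; rewrite expr1n mulr1.
split=> k nk.
  have SE x : S_ (J 0%N 1%N) k x =
      (jweight 0 1).[x] * (\sum_(l < k.+1) (J 0%N 1%N l).[x] ^+ 2).
    by rewrite horner_jweight expr0 expr1 mul1r.
  have J01 := hJ 0%N 1%N isT isT.
  set D := Num.max _ _; apply: monotone_deriv_sharp => //.
  - by rewrite le_max SE kernel_ge0.
  - move=> G sG G0; apply: (@wsos_le_pint _ (2 * k + 1)); last first.
      by apply: nonneg_wsos => //; rewrite (leq_trans sG)// nk; lia.
    (* The derivative has odd degree bound [2 * k + 1], so exactly one of [a], [b] is 1 and
       [s = k + 1]. *)
    move=> [|[|//]] [|[|//]] s A _ _ abs As; try by lia.
    + have sk : s = k.+1 by lia.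
      rewrite sk in As; apply: (jacobi_kernel_bound_le J01 As) => //.
      by rewrite -SE le_max lexx.
    + have sk : s = k.+1 by lia.
      (* Weight [1 - X] at [x0] becomes weight [1 + X] at [- x0], with the same integral. *)
      rewrite -pint_reflect -{1}(opprK x0) -horner_reflect jweight_reflect.
      rewrite sk -size_reflect in As; apply: (jacobi_kernel_bound_le J01 As) => //.
      by rewrite -SE le_max lexx orbT.
  - have sw (A : {poly R}) : (size A <= k.+1)%N ->
        (size (jweight 0 1 * A ^+ 2)%R <= n)%N.
      rewrite /jweight expr0 expr1 mul1r => As.
      rewrite nk expr2 (leq_trans (size_mul_le2 size_onepX (leqnn _)))//.
      by have := size_polyMleq A A; lia.
    move=> c c0 cG; rewrite ge_max !SE; apply/andP; split.
      apply: jacobi_kernel_sharp => // A As.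
      by apply: cG; [exact: sw|exact: nonneg_jweight_sqr].
    apply: jacobi_kernel_sharp => // A As.
    rewrite -horner_reflect -pint_reflect; apply: cG.
      by rewrite size_reflect sw.
    by rewrite jweight_reflect; exact: nonneg_jweight_sqr.
have FE : F_ (J 0%N 0%N) k x0 =
    (jweight 0 0).[x0] * (\sum_(l < k.+1) (J 0%N 0%N l).[x0] ^+ 2).
  by rewrite horner_jweight !expr0 !mul1r.
have HE : H_ (J 1%N 1%N) k x0 =
    (jweight 1 1).[x0] * (\sum_(l < k) (J 1%N 1%N l).[x0] ^+ 2).
  by rewrite horner_jweight !expr1 /H_; congr (_ * _); ring.
have J00 := hJ 0%N 0%N isT isT.
have J11 := hJ 1%N 1%N isT isT.
set D := Num.max _ _; apply: monotone_deriv_sharp => //.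
- by rewrite le_max FE kernel_ge0.
- move=> G sG G0; apply: (@wsos_le_pint _ (2 * k)); last first.
    by apply: nonneg_wsos => //; rewrite (leq_trans sG)// nk; lia.
  (* The degree bound [2 * k] is even: either [a = b = 0] with [s = k + 1], or [a = b = 1] with
     [s = k], whence the shorter sum in [H_]. *)
  move=> [|[|//]] [|[|//]] s A _ _ abs As; try by lia.
  + have sk : s = k.+1 by lia.
    rewrite sk in As; apply: (jacobi_kernel_bound_le J00 As) => //.
    by rewrite -FE le_max lexx.
  + have sk : s = k by lia.
    rewrite sk in As; apply: (jacobi_kernel_bound_le J11 As) => //.
    by rewrite -HE le_max lexx orbT.
- move=> c c0 cG; rewrite ge_max FE HE; apply/andP; split.
    apply: jacobi_kernel_sharp => // A As.
    apply: cG; last exact: nonneg_jweight_sqr.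
    rewrite /jweight !expr0 !mul1r nk expr2 (leq_trans (size_polyMleq _ _))//.
    by move: As; lia.
  apply: jacobi_kernel_sharp => // A As.
  apply: cG; last exact: nonneg_jweight_sqr.
  (* For [A = 0] the size estimate below gives only 2, which exceeds [n = 1] when [k = 0]. *)
  have [->|A0] := eqVneq A 0; first by rewrite expr0n mulr0 size_poly0.
  rewrite /jweight !expr1 nk expr2 -mulrA.
  have sM1 := size_mul_le2 size_onepX (leqnn (size (A * A)%R)).
  apply: leq_trans (size_mul_le2 size_onemX sM1) _.
  by move: (size_polyMleq A A) As A0; rewrite -size_poly_gt0; lia.
Qed.
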